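(* Let $n$ be a positive integer, $p$ a prime number and $q$ a power of $p$, with $\gcd(n,q)=1$. Let $\mathbb{L}|\mathbb{F}_q$ be a field extension such that $U_n\subseteq \mathbb{L}$. Let $C$ be a nonzero cyclic code in $\mathbb{F}_q(n)$. Then $d(C)=\Delta(C)$ if and only if there exists a polynomial $f\in \mathbb{L}(n)$ such that (1) $d^\ast(f)=d^\ast(C)$; (2) $d^\ast(f)=n-\deg(m_f)$; (3) $\varphi^{-1}_{\alpha,f}\in C$ for some $\alpha\in\mathcal{R}(C)$. Moreover, in this case (for such an $f$), there exists $h\in\{0,\dots,n-1\}$ such that $\overline{x^hf}\mid x^n-1$.
   Context: $U_n$ is the set of primitive $n$-th roots of unity. For a field $F$, $F(n)=F[x]/(x^n-1)$; its elements are identified with polynomials of degree $<n$, and $\overline{f}$ is the image of $f\in F[x]$ in $F(n)$, i.e. its remainder modulo $x^n-1$. A cyclic code is an ideal $C$ of $\mathbb{F}_q(n)$; $\omega(c)$ is the number of nonzero coefficients of $c$, and $d(C)=\min\{\omega(c): 0\neq c\in C\}$. For $\alpha\in U_n$, the defining set is $D_\alpha(C)=\{i\in\mathbb{Z}_n : c(\alpha^i)=0 \text{ for all } c\in C\}$. The BCH bounds of $C$ are the integers $\delta$ such that, for some $\alpha\in U_n$, $D_\alpha(C)$ contains $\delta-1$ consecutive integers modulo $n$; $\Delta(C)$ is the maximum of the BCH bounds of $C$. For $f\in\mathbb{F}_q(n)$ (or $\mathbb{L}(n)$) and $\alpha\in U_n$, the Fourier transform is $\varphi_{\alpha,f}(x)=\sum_{j=0}^{n-1}f(\alpha^j)x^j\in\mathbb{L}(n)$,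 with inverse $\varphi^{-1}_{\alpha,g}(x)=\frac1n\sum_{i=0}^{n-1}g(\alpha^{-i})x^i$ for $g\in\mathbb{L}(n)$. The apparent distance of $g\in\mathbb{L}(n)$ is $d^\ast(0)=0$ and, for $g\ne0$, $d^\ast(g)=\max\{n-\deg(\overline{x^hg}): 0\le h\le n-1\}$. For a nonzero cyclic code $C$: $d^\ast_\alpha(C)=\min_{0\ne c\in C}d^\ast(\varphi_{\alpha,c})$, $d^\ast(C)=\max_{\alpha\in U_n}d^\ast_\alpha(C)$, and $\mathcal{R}(C)=\{\beta\in U_n: d^\ast_\beta(C)=d^\ast(C)\}$. It is a known fact (Camion) that $d^\ast(C)=\Delta(C)$. For $g\in\mathbb{L}(n)$ (viewed as a polynomial of degree $<n$), $m_g=\gcd(g,x^n-1)$ (which equals $\gcd(x^hg,x^n-1)$ for all $h\ge 0$). *)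

(* Defs.v *)
From HB Require Import structures.
From mathcomp Require Import all_boot all_order all_algebra.
From mathcomp Require Import classical_sets.

Set Implicit Arguments.
Unset Strict Implicit.
Unset Printing Implicit Defensive.

Import GRing.Theory.
Local Open Scope ring_scope.

(* R(n) = R[x]/(x^n - 1); its elements coerce to polynomials of degree < n.
   For n > 0 the modulus is monic and nonconstant, so that the default modulus
   'X of [mk_monic] is not used. *)
Notation cyc R n := {poly %/ ('X^n - 1 : {poly R})}.

(* The default value 0 occurs only when P has no greatest (least) element. *)
Definition nat_max (P : nat -> Prop) : nat :=
  xget 0%N [set m | P m /\ forall k, P k -> (k <= m)%N]%classic.

Definition nat_min (P : nat -> Prop) : nat :=
  xget 0%N [set m | P m /\ forall k, P k -> (m <= k)%N]%classic.

Lemma nat_max_eq (P : nat -> Prop) (m : nat) :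
  P m -> (forall k, P k -> (k <= m)%N) -> nat_max P = m.
Proof.
move=> Pm Pub; apply: xget_unique => // k [Pk kub].
by apply/eqP; rewrite eqn_leq Pub //= kub.
Qed.

Lemma nat_min_eq (P : nat -> Prop) (m : nat) :
  P m -> (forall k, P k -> (m <= k)%N) -> nat_min P = m.
Proof.
move=> Pm Plb; apply: xget_unique => // k [Pk klb].
by apply/eqP; rewrite eqn_leq Plb // andbT klb.
Qed.

(* [idealr_closed] is not used because it requires the ideal to be proper,
   whereas C = F(n) is a cyclic code. *)
Definition cyclic_code (F : finFieldType) (n : nat) (C : {set cyc F n}) : Prop :=
  [/\ 0 \in C,
      forall u v : cyc F n, u \in C -> v \in C -> u + v \in C
    & forall a u : cyc F n, u \in C -> a * u \in C].

Definition weight (R : nzRingType) (n : nat) (c : cyc R n) : nat :=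
  #|[set i : 'I_n | (c : {poly R})`_i != 0]|.

Definition min_dist (F : finFieldType) (n : nat) (C : {set cyc F n}) : nat :=
  nat_min (fun w => exists c : cyc F n, [/\ c \in C, c != 0 & w = weight c]).

(* The extension L | F is given by a field morphism iota : F -> L, and U_n is
   the predicate n.-primitive_root on L. *)
Definition defining_set (F : finFieldType) (L : fieldType)
    (iota : {rmorphism F -> L}) (n : nat) (a : L) (C : {set cyc F n}) :
    {set 'I_n} :=
  [set i : 'I_n | [forall c in C, (map_poly iota c).[a ^+ i] == 0]].

(* D_a(C) contains the residues of b, b + 1, ..., b + delta - 2 modulo n. *)
Definition bch_bound (F : finFieldType) (L : fieldType)
    (iota : {rmorphism F -> L}) (n : nat) (C : {set cyc F n}) (delta : nat) :
    Prop :=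
  (0 < delta)%N /\
  exists2 a : L, n.-primitive_root a &
  exists b : nat, forall (k : nat) (i : 'I_n),
    (k < delta.-1)%N -> i = b + k %[mod n] -> i \in defining_set iota a C.

Definition max_bch_bound (F : finFieldType) (L : fieldType)
    (iota : {rmorphism F -> L}) (n : nat) (C : {set cyc F n}) : nat :=
  nat_max (bch_bound iota C).

(* The argument is a polynomial over L, so that this applies to L(n) and, after
   [map_poly iota], to F(n). *)
Definition fourier (L : fieldType) (n : nat) (a : L) (f : {poly L}) : cyc L n :=
  in_qpoly ('X^n - 1) (\poly_(j < n) f.[a ^+ j]).

Definition inv_fourier (L : fieldType) (n : nat) (a : L) (g : cyc L n) :
    cyc L n :=
  in_qpoly ('X^n - 1) (\poly_(i < n) (n%:R^-1 * (g : {poly L}).[a ^- i])).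

Definition shift (L : fieldType) (n h : nat) (g : cyc L n) : cyc L n :=
  in_qpoly ('X^n - 1) ('X^h * (g : {poly L})).

Definition deg (R : nzRingType) (p : {poly R}) : nat := (size p).-1.

Definition app_dist (L : fieldType) (n : nat) (g : cyc L n) : nat :=
  if g == 0 then 0%N else \max_(h < n) (n - deg (shift h g))%N.

Definition app_dist_at (F : finFieldType) (L : fieldType)
    (iota : {rmorphism F -> L}) (n : nat) (a : L) (C : {set cyc F n}) : nat :=
  nat_min (fun d => exists c : cyc F n,
    [/\ c \in C, c != 0 & d = app_dist (fourier n a (map_poly iota c))]).

Definition app_dist_code (F : finFieldType) (L : fieldType)
    (iota : {rmorphism F -> L}) (n : nat) (C : {set cyc F n}) : nat :=
  nat_max (fun d => exists2 a : L, n.-primitive_root a &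
                      d = app_dist_at iota a C).

Definition optimal_root (F : finFieldType) (L : fieldType)
    (iota : {rmorphism F -> L}) (n : nat) (C : {set cyc F n}) (a : L) : Prop :=
  n.-primitive_root a /\ app_dist_at iota a C = app_dist_code iota C.

(* [gcdp] is determined up to a nonzero scalar; only the degree is used. *)
Definition gcd_xn1 (L : fieldType) (n : nat) (g : cyc L n) : {poly L} :=
  gcdp g ('X^n - 1).

(* Main.v *)
Require Import Defs.
From HB Require Import structures.
From mathcomp Require Import all_boot all_order all_algebra.
From mathcomp Require Import boolp zify.

(* Fourier inversion turns the weight of c into the number of n-th roots of
   unity that are not zeros of the spectrum f of c, that is n - deg m_f. As m_f
   divides every shift of f, d*(f) <= n - deg m_f, with equality exactly when
   some shift of f is associate to m_f, a divisor of X^n - 1. On the other hand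
   d*(f) - 1 is the length of the longest cyclic run of zero coefficients of f,
   which gives Camion's d*(C) = Delta(C): the minimum over C is reached at a
   generator, whose zeros among the n-th roots of unity are those of C. So
   Delta(C) = d*(C) <= d(C), and equality means that a codeword of minimum
   weight has a spectrum f with d*(C) = d*(f) = n - deg m_f. *)

Set Implicit Arguments.
Unset Strict Implicit.
Unset Printing Implicit Defensive.

Import GRing.Theory.
Local Open Scope ring_scope.

(** * Extrema of predicates on the natural numbers *)

Lemma nat_max_spec (P : nat -> Prop) (B : nat) :
  (exists k, P k) -> (forall k, P k -> (k <= B)%N) ->
  P (nat_max P) /\ forall k, P k -> (k <= nat_max P)%N.
Proof.
move=> exP ubP.
have exP' : exists k, `[< P k >] by have [k Pk] := exP; exists k; apply/asboolP.
have ubP' k : `[< P k >] -> (k <= B)%N by move/asboolP; apply: ubP.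
have [m /asboolP Pm mub] := ex_maxnP exP' ubP'.
have mubP k : P k -> (k <= m)%N by move=> Pk; apply/mub/asboolP.
by rewrite (nat_max_eq Pm mubP).
Qed.

Lemma nat_min_spec (P : nat -> Prop) :
  (exists k, P k) ->
  P (nat_min P) /\ forall k, P k -> (nat_min P <= k)%N.
Proof.
move=> exP.
have exP' : exists k, `[< P k >] by have [k Pk] := exP; exists k; apply/asboolP.
have [m /asboolP Pm mlb] := ex_minnP exP'.
have mlbP k : P k -> (m <= k)%N by move=> Pk; apply/mlb/asboolP.
by rewrite (nat_min_eq Pm mlbP).
Qed.

(** * Cyclic shifts and the apparent distance *)

Section Cyclic.
Variables (R : fieldType) (n : nat) (n_gt0 : (0 < n)%N).
Local Notation M := ('X^n - 1 : {poly R}).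
Implicit Type g : cyc R n.

Lemma mk_monic_Xn_sub_1 : mk_monic M = M.
Proof. by rewrite /mk_monic size_Xn_sub_1 // ltnS n_gt0 monic_Xn_sub_1. Qed.

Lemma size_cyc g : (size (g : {poly R}) <= n)%N.
Proof.
rewrite -ltnS (leq_trans (size_mk_monic g)) //.
by rewrite mk_monic_Xn_sub_1 size_Xn_sub_1.
Qed.

Lemma deg_cyc_lt g : (deg (g : {poly R}) < n)%N.
Proof. by rewrite /deg; case: (size _) (size_cyc g) => [|k]. Qed.

Lemma in_cycE (p : {poly R}) : in_qpoly M p = p %% M :> {poly R}.
Proof.
by rewrite /= mk_monic_Xn_sub_1 Pdiv.IdomainMonic.modpE // monic_Xn_sub_1.
Qed.

Lemma in_cyc_small (p : {poly R}) :
  (size p <= n)%N -> in_qpoly M p = p :> {poly R}.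
Proof.
by move=> sp; rewrite in_qpoly_small // mk_monic_Xn_sub_1 size_Xn_sub_1.
Qed.

Lemma in_cyc_val g : in_qpoly M (g : {poly R}) = g.
Proof. exact/val_inj/in_cyc_small/size_cyc. Qed.

Lemma dvdp_Xn_sub_Xmod m : M %| 'X^m - 'X^(m %% n).
Proof.
rewrite {1}(divn_eq m n) addnC exprD mulnC exprM -{2}['X^(_ %% _)]mulr1.
by rewrite -mulrBr dvdp_mull // (subrX1 'X^n) dvdp_mulr.
Qed.

(** The right-hand side has size at most [n] and is congruent to ['X^h * g], hence is its remainder:
    a shift rotates the coefficients. *)
Lemma shiftE h g :
  shift h g = \sum_(j < n) (g : {poly R})`_j *: 'X^((h + j) %% n) :> {poly R}.
Proof.
set S := \sum_(j < n) _.
have szS : (size S <= n)%N.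
  apply: (leq_trans (size_sum _ _ _)); apply/bigmax_leqP => j _.
  by rewrite (leq_trans (size_scale_leq _ _)) // size_polyXn ltn_pmod.
have eqg : (g : {poly R}) = \sum_(j < n) (g : {poly R})`_j *: 'X^j.
  rewrite -poly_def; apply/polyP => i; rewrite coef_poly; case: ltnP => // ni.
  by rewrite nth_default // (leq_trans (size_cyc g)).
rewrite in_cycE -[X in X %% _](subrK S) modpD.
rewrite [X in _ + X]modp_small ?size_Xn_sub_1 ?ltnS //.
have /modp_eq0P -> : M %| 'X^h * (g : {poly R}) - S; last by rewrite add0r.
rewrite [in X in X - S]eqg mulr_sumr -sumrB.
apply: (big_ind (fun p => M %| p)) => [|u v|j _]; rewrite ?dvdp0 //.
  exact: dvdp_add.
by rewrite -scalerAr -exprD -scalerBr -mul_polyC dvdp_mull ?dvdp_Xn_sub_Xmod.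
Qed.

Lemma coef_shift h g j :
  (shift h g : {poly R})`_((h + j) %% n) = (g : {poly R})`_(j %% n).
Proof.
rewrite shiftE coef_sum (bigD1 (Ordinal (ltn_pmod j n_gt0))) //=.
rewrite coefZ coefXn modnDmr eqxx mulr1 big1 ?addr0 // => k nkj.
rewrite coefZ coefXn eqn_modDl.
rewrite -(inj_eq val_inj) /= in nkj.
by rewrite (modn_small (ltn_ord k)) eq_sym (negPf nkj) mulr0.
Qed.

Lemma shift_neq0 h g : g != 0 -> shift h g != 0.
Proof.
apply: contraNneq => s0; apply/eqP/val_inj/polyP => j; rewrite coef0.
have [nj|jn] := leqP n j.
  by rewrite nth_default // (leq_trans (size_cyc g)).
by rewrite -(modn_small jn) -(coef_shift h) s0 coef0.
Qed.

Lemma gcd_dvd_shift h g : gcd_xn1 g %| (shift h g : {poly R}).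
Proof. by rewrite in_cycE -dvdp_mod ?dvdp_gcdr // dvdp_mull // dvdp_gcdl. Qed.

Lemma app_dist_attained g :
  g != 0 -> exists h : 'I_n, app_dist g = (n - deg (shift h g : {poly R}))%N.
Proof.
move=> gn0; rewrite /app_dist (negPf gn0).
have [|h ->] := @eq_bigmax 'I_n (fun h => n - deg (shift h g : {poly R}))%N.
  by rewrite card_ord.
by exists h.
Qed.

Lemma app_dist_gt0 g : (0 < app_dist g)%N = (g != 0).
Proof.
have [->|gn0] := eqVneq g 0; first by rewrite /app_dist eqxx.
by have [h ->] := app_dist_attained gn0; rewrite subn_gt0 deg_cyc_lt.
Qed.

Lemma app_dist_le_gcd g : (app_dist g <= n - deg (gcd_xn1 g))%N.
Proof.
have [->|gn0] := eqVneq g 0; first by rewrite /app_dist eqxx.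
have [h ->] := app_dist_attained gn0.
rewrite leq_sub2l // /deg -!subn1 leq_sub2r //.
by rewrite dvdp_leq ?gcd_dvd_shift //; apply: shift_neq0.
Qed.

Lemma cyc_coef_modP g : (forall j, (g : {poly R})`_(j %% n) = 0) -> g = 0.
Proof.
move=> g0; apply/val_inj/polyP => j; rewrite coef0.
have [nj|jn] := leqP n j.
  by rewrite nth_default // (leq_trans (size_cyc g)).
by rewrite -(modn_small jn).
Qed.

(** Rotating the run of zeros to the top degrees leaves a shift of degree at most [n - d]. *)
Lemma app_dist_ge_run g b d :
    g != 0 -> (0 < d)%N ->
    (forall k, (k < d.-1)%N -> (g : {poly R})`_((b + k) %% n) = 0) ->
  (d <= app_dist g)%N.
Proof.
move=> gn0 d_gt0 g0.
(* If [d > n], the run has at least [n] zeros, covers all residues and forces [g = 0]. *)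
have dn : (d <= n)%N.
  rewrite leqNgt; apply/negP => nd; case/eqP: gn0; apply: cyc_coef_modP => j.
  rewrite -[RHS](g0 ((j + (n - b %% n)) %% n)%N); last first.
    by rewrite (leq_trans (ltn_pmod _ n_gt0)) // -ltnS prednK.
  rewrite modnDmr -modnDml addnCA subnKC ?modnDr //.
  by rewrite ltnW ?ltn_pmod.
(* This shift carries [b + d.-1], the index just past the run, to 0, so that the run fills the
   degrees from [n - d.-1] to [n - 1]. *)
pose h := ((n - (b + d.-1) %% n) %% n)%N.
have hn : (h < n)%N by rewrite ltn_pmod.
rewrite /app_dist (negPf gn0); apply: (bigmax_sup (Ordinal hn)) => //.
suff szs : (size (shift h g : {poly R}) <= n - d.-1)%N.
  have aux s : (s <= n - d.-1)%N -> (d <= n - s.-1)%N by lia.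
  exact: aux szs.
apply/leq_sizeP => i le_i.
have [ni|lt_in] := leqP n i.
  by rewrite nth_default // (leq_trans (size_cyc _)).
pose k := (i - (n - d.-1))%N.
have -> : i = ((h + (b + k)) %% n)%N.
  rewrite -[LHS](modn_small lt_in); apply/eqP.
  have hb : ((h + (b + d.-1)) %% n = 0)%N.
    by rewrite modnDml -modnDmr subnK ?modnn // ltnW ?ltn_pmod.
  rewrite eq_sym -(eqn_modDr d.-1).
  have -> : (h + (b + k) + d.-1 = h + (b + d.-1) + k)%N by lia.
  have -> : (i + d.-1 = k + n)%N by rewrite /k; lia.
  by rewrite -modnDml hb modnDr.
by rewrite coef_shift g0 // /k; lia.
Qed.

(** A shift that attains [d = app_dist g] has degree [n - d], so its [d - 1] top coefficients
    vanish; rotating back gives the run. *)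
Lemma app_dist_run g :
  g != 0 ->
  exists b, forall k, (k < (app_dist g).-1)%N ->
    (g : {poly R})`_((b + k) %% n) = 0.
Proof.
move=> gn0; have [h dE] := app_dist_attained gn0.
have degs := deg_cyc_lt (shift h g).
set d := app_dist g in dE *.
(* The zeros of the shift start at [n - d.-1]; adding [n - h] undoes the rotation modulo [n]. *)
exists (n - d.-1 + (n - h))%N => k kd.
rewrite -(coef_shift h).
have -> : (h + (n - d.-1 + (n - h) + k) = n - d.-1 + k + n)%N.
  by have := ltn_ord h; lia.
rewrite modnDr modn_small; last by move: dE kd; lia.
by rewrite nth_default // (leq_trans (leqSpred _)) // -/(deg _); lia.
Qed.

(** * Fourier inversion and zeros at roots of unity *)

Section Fourier.
Variables (a : R) (prim_a : n.-primitive_root a).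

(** For [i != j] the sum is geometric with ratio an [n]-th root of unity [w != 1], and [w - 1] times
    it is [w ^+ n - 1 = 0]. *)
Lemma sum_expr_prim_root i j :
  (i < n)%N -> (j < n)%N ->
  \sum_(k < n) (a ^+ k) ^+ i * (a ^- j) ^+ k = n%:R * (i == j)%:R.
Proof.
move=> lt_in lt_jn.
have a_neq0 : a != 0 by rewrite (prim_root_eq0 prim_a) -lt0n.
have -> : \sum_(k < n) (a ^+ k) ^+ i * (a ^- j) ^+ k
        = \sum_(k < n) (a ^+ i / a ^+ j) ^+ k.
  by apply: eq_bigr => k _; rewrite exprMn exprAC.
have [->|neq_ij] := eqVneq i j.
  rewrite divff ?expf_neq0 // mulr1 (eq_bigr (fun=> 1)) => [|k _].
    by rewrite sumr_const card_ord.
  by rewrite expr1n.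
rewrite mulr0; apply/eqP; set w := _ / _.
have w_neq1 : w - 1 != 0.
  rewrite subr_eq0; apply: contra_neq neq_ij => w1.
  have /eqP : a ^+ i = a ^+ j.
    by rewrite -[LHS](divfK (expf_neq0 j a_neq0)) -/w w1 mul1r.
  by rewrite (eq_prim_root_expr prim_a) !modn_small // => /eqP.
have wn1 : w ^+ n = 1.
  rewrite exprMn exprVn !(exprAC _ _ n) (prim_expr_order prim_a).
  by rewrite !expr1n invr1 mulr1.
by rewrite -(mulrI_eq0 _ (mulfI w_neq1)) -subrX1 wn1 subrr.
Qed.

Lemma coef_fourier (f : {poly R}) j :
  (j < n)%N -> (fourier n a f : {poly R})`_j = f.[a ^+ j].
Proof. by move=> lt_jn; rewrite in_cyc_small ?size_poly // coef_poly lt_jn. Qed.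

Lemma coef_inv_fourier g j :
  (j < n)%N ->
  (inv_fourier a g : {poly R})`_j = n%:R^-1 * (g : {poly R}).[a ^- j].
Proof. by move=> lt_jn; rewrite in_cyc_small ?size_poly // coef_poly lt_jn. Qed.

(** Exchanging the two sums reduces inversion to orthogonality; the existence of a primitive [n]-th
    root makes [n] invertible in [R]. *)
Lemma fourierK (f : {poly R}) :
  (size f <= n)%N -> inv_fourier a (fourier n a f) = f :> {poly R}.
Proof.
move=> szf; apply/polyP => j.
have [nj|lt_jn] := leqP n j.
  by rewrite !nth_default ?(leq_trans _ nj) ?size_cyc.
rewrite coef_inv_fourier // (horner_coef_wide _ (size_cyc _)).
under eq_bigr => k _.
  rewrite coef_fourier // (horner_coef_wide _ szf) mulr_suml.
  under eq_bigr => i _ do rewrite -mulrA.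
  over.
rewrite exchange_big /=.
under eq_bigr => i _ do rewrite -mulr_sumr sum_expr_prim_root // mulrCA.
rewrite -mulr_sumr mulKf ?(prim_root_natf_neq0 prim_a) //.
rewrite (bigD1 (Ordinal lt_jn)) //= eqxx mulr1 big1 ?addr0 // => i neq_ij.
by rewrite -(inj_eq val_inj) /= in neq_ij; rewrite (negPf neq_ij) mulr0.
Qed.

Lemma fourier_neq0 (f : {poly R}) :
  (size f <= n)%N -> f != 0 -> fourier n a f != 0.
Proof.
move=> szf; apply: contra_neq => f0; rewrite -(fourierK szf) f0.
apply/polyP => j; rewrite coef0; have [nj|lt_jn] := leqP n j.
  by rewrite nth_default // (leq_trans (size_cyc _)).
by rewrite coef_inv_fourier //= horner0 mulr0.
Qed.

(** ['X^n - 1] splits into distinct linear factors, and the gcd is associate to the product [P] of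
    those whose root is a zero of [g]. *)
Lemma deg_gcd_xn1 g :
  deg (gcd_xn1 g) = #|[set i : 'I_n | root (g : {poly R}) (a ^+ i)]|.
Proof.
pose r (i : 'I_n) := root (g : {poly R}) (a ^+ i).
pose P := \prod_(i < n | r i) ('X - (a ^+ i)%:P).
pose Q := \prod_(i < n | ~~ r i) ('X - (a ^+ i)%:P).
have PQ : P * Q = M.
  by rewrite -(factor_Xn_sub_1 prim_a) big_mkord [RHS](bigID r).
have GP : gcd_xn1 g %| P.
  (* No root of [Q] is a zero of [g], so the gcd is coprime to [Q]; dividing [P * Q], it divides
     [P]. *)
  rewrite -(@Gauss_dvdpl _ _ Q) ?PQ ?dvdp_gcdr //.
  apply: (big_ind (fun q => coprimep (gcd_xn1 g) q)) => [|u v|i ri].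
  - exact: coprimep1.
  - by rewrite coprimepMr => -> ->.
  rewrite coprimep_XsubC; apply: contra ri; rewrite /r -!dvdp_XsubCl => h.
  exact: dvdp_trans h (dvdp_gcdl _ _).
pose rs := [seq a ^+ (i : 'I_n) | i <- enum [set i | r i]].
have Prs : P = \prod_(z <- rs) ('X - z%:P).
  by rewrite big_map big_enum /=; apply: eq_bigl => i; rewrite inE.
have Pg : P %| (g : {poly R}).
  rewrite Prs; apply: uniq_roots_dvdp.
    by apply/allP => z /mapP[i]; rewrite mem_enum inE => ri ->.
  rewrite uniq_rootsE map_inj_uniq ?enum_uniq // => i j /eqP.
  by rewrite (eq_prim_root_expr prim_a) !modn_small // => /eqP/val_inj.
have PG : P %| gcd_xn1 g by rewrite dvdp_gcd Pg -PQ dvdp_mulr.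
have /eqp_size sz : gcd_xn1 g %= P by rewrite /eqp GP PG.
by rewrite /deg sz Prs size_prod_XsubC size_map -cardE.
Qed.


Lemma prim_root_inv : n.-primitive_root a^-1.
Proof.
have -> : a^-1 = a ^+ n.-1.
  have a_neq0 : a != 0 by rewrite (prim_root_eq0 prim_a) -lt0n.
  apply: (mulfI a_neq0).
  by rewrite divff // -exprS prednK // (prim_expr_order prim_a).
by rewrite (prim_root_exp_coprime _ prim_a) -{2}(prednK n_gt0) coprimenS.
Qed.
End Fourier.

(** Coefficient [i] is the value of [g] at [a ^- i] up to the factor [n%:R^-1], so the zeros of [g]
    are counted along the powers of [a^-1]. *)
Lemma weight_inv_fourier a g :
  n.-primitive_root a -> weight (inv_fourier a g) = (n - deg (gcd_xn1 g))%N.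
Proof.
move=> prim_a; rewrite (deg_gcd_xn1 (prim_root_inv prim_a)) /weight.
set S := [set i : 'I_n | _]; set T := [set i : 'I_n | _].
have -> : S = ~: T.
  apply/setP => i; rewrite !inE coef_inv_fourier // -exprVn.
  rewrite mulf_eq0 invr_eq0 (negPf (prim_root_natf_neq0 prim_a)).
  by rewrite /root.
by have := cardsC T; rewrite card_ord; lia.
Qed.

Lemma app_dist_le_weight a (c : cyc R n) :
  n.-primitive_root a -> (app_dist (fourier n a c) <= weight c)%N.
Proof.
move=> prim_a; rewrite -{2}(val_inj (fourierK prim_a (size_cyc c))).
by rewrite weight_inv_fourier // app_dist_le_gcd.
Qed.
End Cyclic.

(** * Cyclic codes: generator, BCH bounds and minimum distance *)

Section Code.
Variables (F : finFieldType) (L : fieldType) (iota : {rmorphism F -> L}).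
Variables (n : nat) (n_gt0 : (0 < n)%N).
Variables (C : {set cyc F n}) (C_code : cyclic_code C) (C_neq0 : C != [set 0]).
Local Notation spectrum a c := (fourier n a (map_poly iota (c : cyc F n))).

(** A nonzero codeword of least degree divides the others by Euclidean division. *)
Lemma cyclic_code_generator :
  exists c0 : cyc F n, [/\ c0 \in C, c0 != 0 &
    forall c : cyc F n, c \in C -> (c0 : {poly F}) %| (c : {poly F})].
Proof.
have [C0 CD CM] := C_code.
have [c1 c1P] : exists c, (c \in C) && (c != 0).
  apply/existsP; apply: contraNT C_neq0; rewrite negb_exists => /forallP C'.
  apply/eqP/setP => c; rewrite inE; apply/idP/eqP => [cC|->//].
  by have := C' c; rewrite cC /= negbK => /eqP.
pose P (c : cyc F n) := (c \in C) && (c != 0).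
have [c0 /andP[c0C c0n0] c0min] :=
  @arg_minnP _ c1 P (fun c => size (c : {poly F})) c1P.
exists c0; split=> // c cC.
have c0n0' : (c0 : {poly F}) != 0 by [].
(* Formed in the quotient ring, [r] lies in the ideal [C]; the polynomial remainder is small enough
   to be its representative. *)
pose r : cyc F n := c - in_qpoly _ ((c : {poly F}) %/ (c0 : {poly F})) * c0.
have rE : r = (c : {poly F}) %% (c0 : {poly F}) :> {poly F}.
  have -> : r = in_qpoly _ ((c : {poly F}) %% (c0 : {poly F})).
    have modE (u v : {poly F}) : u %% v = u - u %/ v * v.
      by rewrite [X in X - _](divp_eq u v) addrC addKr.
    by rewrite modE rmorphB rmorphM /= !in_cyc_val.
  by rewrite in_cyc_small // (leq_trans (ltnW (ltn_modpN0 _ c0n0'))) ?size_cyc.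
have rC : r \in C by rewrite CD // -[X in X \in C]mulN1r CM // CM.
apply/modp_eq0P; rewrite -rE; have [->//|rn0] := eqVneq r 0.
have := c0min r; rewrite /P rC rn0 => /(_ isT).
by rewrite leqNgt rE ltn_modp c0n0'.
Qed.

Lemma size_map_cyc (c : cyc F n) :
  (size (map_poly iota (c : {poly F})) <= n)%N.
Proof. by rewrite size_map_poly size_cyc. Qed.

Lemma spectrum_neq0 a (c : cyc F n) :
  n.-primitive_root a -> c != 0 -> spectrum a c != 0.
Proof.
by move=> prim_a cn0; rewrite fourier_neq0 ?size_map_cyc ?map_poly_eq0.
Qed.

Lemma weight_map_cyc (c : cyc F n) (c' : cyc L n) :
  map_poly iota (c : {poly F}) = c' :> {poly L} -> weight c' = weight c.
Proof.
by move=> cc'; apply: eq_card => i; rewrite !inE -cc' coef_map fmorph_eq0.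
Qed.

Lemma app_dist_le_weight_map a (c : cyc F n) :
  n.-primitive_root a -> (app_dist (spectrum a c) <= weight c)%N.
Proof.
move=> prim_a.
have cE := in_cyc_small n_gt0 (size_map_cyc c).
by rewrite -(weight_map_cyc (esym cE)) -{1}cE app_dist_le_weight.
Qed.

(** [C] has a nonzero codeword, so the minimum is attained and is not the default of [nat_min]. *)
Lemma app_dist_at_spec a :
  (exists c : cyc F n, [/\ c \in C, c != 0 &
     app_dist_at iota a C = app_dist (spectrum a c)]) /\
  (forall c : cyc F n, c \in C -> c != 0 ->
     (app_dist_at iota a C <= app_dist (spectrum a c))%N).
Proof.
have [c0 [c0C c0n0 _]] := cyclic_code_generator.
pose P d := exists c : cyc F n,
  [/\ c \in C, c != 0 & d = app_dist (spectrum a c)].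
have exP : exists d, P d by eexists; exists c0; split.
have [Pmin minP] := nat_min_spec exP.
by split=> // c cC cn0; apply: minP; exists c.
Qed.

Lemma app_dist_at_bounds a :
  n.-primitive_root a -> (0 < app_dist_at iota a C <= n)%N.
Proof.
move=> prim_a; have [[c [_ cn0 ->]] _] := app_dist_at_spec a.
rewrite app_dist_gt0 // spectrum_neq0 //=.
by rewrite (leq_trans (app_dist_le_gcd _ _)) ?leq_subr.
Qed.

Lemma mem_defining_set a (i : 'I_n) (c : cyc F n) :
  i \in defining_set iota a C -> c \in C ->
  (map_poly iota (c : {poly F})).[a ^+ i] = 0.
Proof. by rewrite inE => /forall_inP h /h /eqP. Qed.

(** A run in the defining set is a run of zeros in the spectrum of every codeword, in particular of
    one that attains the minimum. *)
Lemma bch_bound_le_app_dist_at delta :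
  bch_bound iota C delta ->
  exists2 a, n.-primitive_root a & (delta <= app_dist_at iota a C)%N.
Proof.
move=> [delta_gt0 [a prim_a [b bP]]]; exists a => //.
have [[c [cC cn0 ->]] _] := app_dist_at_spec a.
apply: (app_dist_ge_run n_gt0 (b := b)); rewrite ?spectrum_neq0 // => k lt_k.
have lt_n : ((b + k) %% n < n)%N by rewrite ltn_pmod.
rewrite coef_fourier //.
apply: (mem_defining_set (i := Ordinal lt_n)) => //.
by apply: bP lt_k _; rewrite /= modn_mod.
Qed.

(* The spectrum of the generator vanishes exactly on the defining set, so that
   its longest cyclic run of zeros is a run in the defining set. *)
Lemma bch_bound_app_dist_at a :
  n.-primitive_root a -> bch_bound iota C (app_dist_at iota a C).
Proof.
move=> prim_a; have /andP[d_gt0 _] := app_dist_at_bounds prim_a.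
split=> //; exists a => //.
have [c0 [c0C c0n0 c0dvd]] := cyclic_code_generator.
have [b bP] := app_dist_run n_gt0 (spectrum_neq0 prim_a c0n0).
exists b => k i lt_k ik; rewrite inE; apply/forall_inP => c cC.
(* The run of the generator is long enough because [app_dist_at iota a C] is a minimum over
   codewords that include [c0]. *)
have lek : (k < (app_dist (spectrum a c0)).-1)%N.
  by have := (app_dist_at_spec a).2 _ c0C c0n0; lia.
have := bP k lek; rewrite -ik modn_small // coef_fourier // => root0.
have : map_poly iota (c0 : {poly F}) %| map_poly iota (c : {poly F}).
  by rewrite dvdp_map c0dvd.
by move=> /dvdpP[u ->]; rewrite hornerM root0 mulr0.
Qed.

Hypothesis Un_L : exists z : L, n.-primitive_root z.

Lemma app_dist_code_spec :
  (exists2 a : L, n.-primitive_root a &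
     app_dist_code iota C = app_dist_at iota a C) /\
  (forall a : L, n.-primitive_root a ->
     (app_dist_at iota a C <= app_dist_code iota C)%N).
Proof.
pose P d := exists2 a : L, n.-primitive_root a & d = app_dist_at iota a C.
have exP : exists d, P d by have [z zP] := Un_L; eexists; exists z.
have ubP k : P k -> (k <= n)%N.
  by move=> [a /app_dist_at_bounds /andP[_ ?] ->].
have [Pmax maxP] := nat_max_spec exP ubP.
by split=> // a prim_a; apply: maxP; exists a.
Qed.

(** Camion's equality: each apparent distance at a primitive root is a BCH bound, and each BCH bound
    is at most one of them. *)
Lemma app_dist_code_bch : app_dist_code iota C = max_bch_bound iota C.
Proof.
have [[a prim_a dE] dmax] := app_dist_code_spec.
apply/esym/nat_max_eq; first by rewrite dE; apply: bch_bound_app_dist_at.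
move=> delta /bch_bound_le_app_dist_at[b prim_b le_b].
exact: leq_trans le_b (dmax b prim_b).
Qed.

Lemma min_dist_spec :
  (exists c : cyc F n, [/\ c \in C, c != 0 & min_dist C = weight c]) /\
  (forall c : cyc F n, c \in C -> c != 0 -> (min_dist C <= weight c)%N).
Proof.
have [c0 [c0C c0n0 _]] := cyclic_code_generator.
pose P w := exists c : cyc F n, [/\ c \in C, c != 0 & w = weight c].
have exP : exists w, P w by eexists; exists c0; split.
have [Pmin minP] := nat_min_spec exP.
by split=> // c cC cn0; apply: minP; exists c.
Qed.

Lemma app_dist_code_le_min_dist : (app_dist_code iota C <= min_dist C)%N.
Proof.
have [[a prim_a ->] _] := app_dist_code_spec.
have [[c [cC cn0 ->]] _] := min_dist_spec.
have [_ dmin] := app_dist_at_spec a.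
exact: leq_trans (dmin c cC cn0) (app_dist_le_weight_map c prim_a).
Qed.
End Code.

Theorem theorem14 (n p q : nat) (n_gt0 : (0 < n)%N) (p_prime : prime p)
  (q_pow : exists2 e : nat, (0 < e)%N & q = (p ^ e)%N) (co_nq : coprime n q)
  (F : finFieldType) (cardF : #|F| = q)
  (L : fieldType) (iota : {rmorphism F -> L})
  (Un_L : exists z : L, n.-primitive_root z)
  (C : {set cyc F n}) (C_code : cyclic_code C) (C_neq0 : C != [set 0]) :
  let good (f : cyc L n) :=
    [/\ app_dist f = app_dist_code iota C,
        app_dist f = (n - deg (gcd_xn1 f))%N
      & exists2 a : L, optimal_root iota C a &
          exists2 c : cyc F n, c \in C &
            map_poly iota c = inv_fourier a f :> {poly L}] in
  (min_dist C = max_bch_bound iota C <-> exists f : cyc L n, good f) /\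
  (forall f : cyc L n, good f ->
     exists h : 'I_n, (shift h f : {poly L}) %| ('X^n - 1 : {poly L})).
Proof.
move=> good.
have code_le := app_dist_code_le_min_dist iota n_gt0 C_code C_neq0 Un_L.
have [[a0 prim_a0 a0E] _] :=
  app_dist_code_spec iota n_gt0 C_code C_neq0 Un_L.
have [_ min_le] := min_dist_spec n_gt0 C_code C_neq0.
have code_gt0 : (0 < app_dist_code iota C)%N.
  rewrite a0E.
  by case/andP: (app_dist_at_bounds iota n_gt0 C_code C_neq0 prim_a0).
(* The apparent distance of 0 is 0, whereas that of the code is positive. *)
have good_neq0 f : good f -> f != 0.
  by case=> fE _ _; rewrite -app_dist_gt0 // fE.
split; last first.
  move=> f gf; have fn0 := good_neq0 f gf; case: gf => _ fm _.
  have [h hE] := app_dist_attained n_gt0 fn0; exists h.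
  have dvd_sh := gcd_dvd_shift n_gt0 h f.
  (* The gcd divides this shift, and condition (2) gives both the same degree. *)
  have gcd_eq : gcd_xn1 f %= (shift h f : {poly L}).
    have fn0' : (f : {poly L}) != 0 := fn0.
    have mn0 : gcd_xn1 f != 0 by rewrite gcdp_eq0 (negPf fn0').
    have sn0 : (shift h f : {poly L}) != 0 := shift_neq0 n_gt0 h fn0.
    rewrite -dvdp_size_eqp //; apply/eqP.
    have aux s t : (0 < s)%N -> (s <= t)%N -> (t.-1 < n)%N ->
      (n - t.-1 = n - s.-1)%N -> s = t by lia.
    apply: aux; rewrite ?size_poly_gt0 //; first exact: dvdp_leq.
      exact: deg_cyc_lt.
    by rewrite -[LHS]hE.
  by rewrite -(eqp_dvdl _ gcd_eq) dvdp_gcdr.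
rewrite -app_dist_code_bch //; split=> [dE | [f gf]].
  have [[c [cC cn0 cE]] _] := min_dist_spec n_gt0 C_code C_neq0.
  have [_ at_le] := app_dist_at_spec iota n_gt0 C_code C_neq0 a0.
  pose f := fourier n a0 (map_poly iota (c : {poly F})).
  have fK : map_poly iota (c : {poly F}) = inv_fourier a0 f :> {poly L}.
    by rewrite fourierK // size_map_cyc.
  have fw : (n - deg (gcd_xn1 f))%N = weight c.
    by rewrite -(weight_inv_fourier n_gt0 f prim_a0) (weight_map_cyc fK).
  (* [app_dist f] lies between [app_dist_at iota a0 C], the apparent distance of the code, and the
     weight of [c], which is [min_dist C]; the two ends agree by [dE]. *)
  have fd : app_dist f = app_dist_code iota C.
    apply/eqP; rewrite eqn_leq -{1}dE cE -fw app_dist_le_gcd //=.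
    by rewrite a0E at_le.
  exists f; split=> //; first by rewrite fd fw -cE dE.
  by exists a0; [split | exists c].
have fn0 := good_neq0 f gf; have [fE fm [a [prim_a _] [c cC cE]]] := gf.
(* By condition (2) the codeword [c] has weight [app_dist f], the apparent distance of the code,
   which bounds [min_dist C] from below. *)
have wE : weight c = app_dist f.
  by rewrite -(weight_map_cyc cE) weight_inv_fourier.
have cn0 : c != 0.
  apply: contraTneq code_gt0 => c0; rewrite -fE -wE c0 -leqNgt leqn0 cards_eq0.
  by apply/eqP/setP => i; rewrite !inE coef0 eqxx.
by apply/eqP; rewrite eqn_leq code_le -fE -wE min_le.
Qed.
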